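(* For every $m\geqslant3$ and every $n\geqslant1$ there exists a real $n\times m$ matrix $\Theta$ whose entries $\theta^i_j$, together with $1$, are linearly independent over $\mathbb Z$, such that for all sufficiently large $\nu$ the extended best approximation vectors $\mathbf z_\nu$ lie in a fixed three-dimensional subspace of $\mathbb R^{m+n}$; that is, $R(\Theta)=3$.
   Context: For a real $n\times m$ matrix $\Theta=(\theta^i_j)$: $L_j(\mathbf x)=\sum_i\theta^i_jx_i$; $\|\cdot\|$ distance to nearest integer; $M(\mathbf x)=\max_i|x_i|$; $\zeta(\mathbf x)=\max_j\|L_j(\mathbf x)\|$. Best approximation: nonzero $\mathbf x\in\mathbb Z^m$ with $\zeta(\mathbf x)\leqslant\zeta(\mathbf x')$ for all nonzero $\mathbf x'$ with $M(\mathbf x')\leqslant M(\mathbf x)$; listed by increasing $M$; extended vectors $\mathbf z_\nu=(\mathbf x_\nu,\mathbf y_\nu)\in\mathbb Z^{m+n}$ with $y_{j,\nu}\in\mathbb Z$, $|L_j(\mathbf x_\nu)+y_{j,\nu}|=\|L_j(\mathbf x_\nu)\|$. $R(\Theta)$: least $r$ such that a lattice $\Lambda\subseteq\mathbb Z^{m+n}$ with $\dim\operatorname{span}\Lambda=r$ contains $\mathbf z_\nu$ for all large $\nu$. *)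

(* Defs.v *)
From mathcomp Require Import all_boot all_order all_algebra.
From mathcomp Require Import all_classical all_reals all_analysis.

Set Implicit Arguments.
Unset Strict Implicit.
Unset Printing Implicit Defensive.

Import Order.TTheory GRing.Theory Num.Theory.

Local Open Scope classical_set_scope.
Local Open Scope ring_scope.

Section BestApproximations.
Context {R : realType}.

(* ||t|| *)
Definition dist_int (t : R) : R := inf [set `|t - k%:~R| | k in [set: int]].

Section Matrix.
Context {m n : nat}.
Implicit Types (Theta : 'M[R]_(n, m)) (x : 'rV[int]_m) (y : 'rV[int]_n).

(* The entry theta^i_j is [Theta j i]: rows of Theta are the linear forms. *)
Definition linform Theta (j : 'I_n) x : R := \sum_(i < m) Theta j i * (x 0 i)%:~R.

Definition height x : nat := (\max_(i < m) absz (x ord0 i))%N.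

(* The default value 0 is harmless, the values of dist_int being nonnegative. *)
Definition zeta Theta x : R :=
  \big[Num.max/0]_(j < n) dist_int (linform Theta j x).

Definition best_approx Theta x : Prop :=
  x != 0 /\
  forall x', x' != 0 -> (height x' <= height x)%N -> zeta Theta x <= zeta Theta x'.

Definition entries_and_1_free Theta : Prop :=
  forall (a : 'M[int]_(n, m)) (b : int),
    \sum_(j < n) \sum_(i < m) (a j i)%:~R * Theta j i + b%:~R = 0 ->
    a = 0 /\ b = 0.

(* Best approximations come in pairs x, -x, of which the list keeps one.  If
   m, n > 0 and the entries of Theta and 1 are independent over Z, then pairs have
   distinct heights and y is determined by x, so that the sequence z is unique
   up to the signs of its terms. *)
Record ext_best_approx_seq Theta (z : nat -> 'rV[int]_(m + n)) : Prop := {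
  ebas_best : forall nu, best_approx Theta (lsubmx (z nu));
  ebas_incr : forall nu, (height (lsubmx (z nu)) < height (lsubmx (z nu.+1)))%N;
  ebas_all : forall x, best_approx Theta x ->
    exists nu, x = lsubmx (z nu) \/ x = - lsubmx (z nu);
  ebas_ext : forall nu j,
    `|linform Theta j (lsubmx (z nu)) + (rsubmx (z nu) 0 j)%:~R|
      = dist_int (linform Theta j (lsubmx (z nu)))
}.

End Matrix.

Definition toR {N : nat} (v : 'rV[int]_N) : 'rV[R]_N := map_mx intr v.

(* Every additive subgroup of Z^N is discrete, hence a lattice, possibly of
   rank smaller than N. *)
Definition int_lattice {N : nat} (L : set 'rV[int]_N) : Prop :=
  L 0 /\ forall u v, L u -> L v -> L (u - v).

Definition is_span {N : nat} (A : set 'rV[R]_N) (V : {vspace 'rV[R]_N}) : Prop :=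
  (forall v, A v -> v \in V) /\
  (forall W : {vspace 'rV[R]_N}, (forall v, A v -> v \in W) -> (V <= W)%VS).

Definition lattice_dim {N : nat} (L : set 'rV[int]_N) (r : nat) : Prop :=
  exists2 V : {vspace 'rV[R]_N}, is_span (toR @` L) V & \dim V = r.

Definition eventually_in_dim {m n : nat} (Theta : 'M[R]_(n, m)) (r : nat) : Prop :=
  exists L : set 'rV[int]_(m + n),
    [/\ int_lattice L, lattice_dim L r &
        forall z, ext_best_approx_seq Theta z -> \forall nu \near \oo, L (z nu)].

Lemma eventually_in_dim_ex {m n : nat} (Theta : 'M[R]_(n, m)) :
  exists r, `[< eventually_in_dim Theta r >].
Proof.
exists (\dim (fullv : {vspace 'rV[R]_(m + n)})); apply/asboolP.
exists setT; split=> //; last by move=> z _; exact: nearW.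
exists fullv => //; split=> [v _|W HW]; first exact: memvf.
apply/subvP=> v _; rewrite (row_sum_delta v); apply: memv_suml => i _.
apply: memvZ; apply: HW; exists (delta_mx 0 i) => //.
by rewrite /toR map_delta_mx.
Qed.

(* R(Theta); by convention 0 if Theta has no sequence z as above, which happens
   only if its entries and 1 are dependent over Z, when m, n > 0. *)
Definition Rdim {m n : nat} (Theta : 'M[R]_(n, m)) : nat :=
  ex_minn (eventually_in_dim_ex Theta).

End BestApproximations.

(* Main.v *)
Require Import Defs.
From mathcomp Require Import all_boot all_order all_algebra.
From mathcomp Require Import all_classical all_reals all_analysis.
From mathcomp Require Import ring lra zify.

Set Implicit Arguments.
Unset Strict Implicit.
Unset Printing Implicit Defensive.

Import Order.TTheory GRing.Theory Num.Theory.

Local Open Scope classical_set_scope.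
Local Open Scope ring_scope.

(* Khintchine's singular systems give numbers w_1, w_2, w_3, independent over Z,
   such that the form w_1 c_1 + w_2 c_2 + w_3 c_3 takes, at nonzero integer points
   of height at most X, values below 1 / F(X), with F growing as fast as we like.
   The first three columns of Theta are lam_j w_i, where the lam_j and the
   remaining entries are chosen generically.  Then every L_j(x) + y with
   (x_4, ..., x_m, y) nonzero has an a priori lower bound which depends on the
   heights only, hence is known before w is chosen; with F fast enough, such points
   cannot be best approximations, which therefore all have y = 0 and x_i = 0 for
   i > 3.  They do not stay in a plane: the products of two consecutive ones would
   be proportional to a fixed bivector, whose contraction with w is nonzero, while
   zeta(x_nu) M(x_(nu+1)) tends to 0. *)

Section RealNumbers.
Context {R : realType}.

Lemma nested_limit (u d : nat -> R) :
    (forall k, u k <= u k.+1) -> (forall k, u k.+1 + d k.+1 <= u k + d k) ->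
    (forall k, 0 <= d k) ->
  exists l, forall k, u k <= l <= u k + d k.
Proof.
move=> umono ud d0.
have uD i k : u k <= u (i + k)%N.
  by elim: i => // i IH; apply: le_trans IH _; rewrite addSn.
have udD i k : u (i + k)%N + d (i + k)%N <= u k + d k.
  by elim: i => // i IH; apply: le_trans IH; rewrite addSn.
have ub k : ubound (range u) (u k + d k).
  move=> _ [i _ <-]; apply: le_trans (udD i k).
  by rewrite ler_wpDr// addnC uD.
exists (sup (range u)) => k; apply/andP; split.
  by apply: ub_le_sup; [exists (u 0%N + d 0%N); exact: ub|exists k].
by apply: ge_sup; [exists (u 0%N); exists 0%N|exact: ub].
Qed.

Definition gap (k : nat) : R := 3^-1 ^+ k / 6.

Lemma gap_gt0 k : 0 < gap k.
Proof. by rewrite divr_gt0// exprn_gt0// invr_gt0. Qed.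

Lemma gap_le k l : (k <= l)%N -> gap l <= gap k.
Proof.
by move=> kl; rewrite ler_pM2r ?invr_gt0// ler_wiXn2l//; lra.
Qed.

Lemma gap_le6 k : gap k <= 6^-1.
Proof. by apply: le_trans (gap_le (leq0n k)) _; rewrite /gap expr0 div1r. Qed.

(* Keep at step k an outer third of the current interval that is away from c k. *)
Lemma avoid_centers (c : nat -> R) :
  exists2 l : R, 1 <= l <= 2 & forall k, gap k <= `|l - c k|.
Proof.
pose L k : R := 3^-1 ^+ k.
pose lo := fix lo k : R := if k is k'.+1 then
  (if lo k' + L k' / 2 <= c k' then lo k' else lo k' + 2 / 3 * L k') else 1.
have L0 k : 0 < L k by rewrite exprn_gt0// invr_gt0.
have LS k : L k.+1 = L k / 3 by rewrite /L exprSr.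
have loS k : lo k.+1 =
  if lo k + L k / 2 <= c k then lo k else lo k + 2 / 3 * L k by [].
have [||k|l Hl] := @nested_limit lo L.
- by move=> k; rewrite loS; have := L0 k; case: ifP => _; lra.
- by move=> k; rewrite loS LS; have := L0 k; case: ifP => _; lra.
- exact: ltW.
exists l; first by have := Hl 0%N; rewrite /= /L expr0; lra.
move=> k; have := Hl k.+1; rewrite LS loS /gap -/(L k); have := L0 k.
by rewrite ler_normr; case: ifPn => [|/negP/negP]; rewrite -?ltNge; lra.
Qed.

(* Choosing t one coordinate at a time, the last coordinate with g p a <> 0
   decides on the size of the sum. *)
Lemma generic_coefficients_seq (A : countType) (g : nat -> A -> R) (b : A -> R) :
  exists2 t : nat -> R, forall l, 1 <= t l <= 2 &
    forall l a, `|g l a| * gap (pickle a) <= `|\sum_(i < l.+1) t i * g i a + b a|.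
Proof.
have step (l : nat) (S : A -> R) : {x : R | 1 <= x <= 2 /\
    forall a, `|g l a| * gap (pickle a) <= `|x * g l a + S a| }.
  apply: cid; pose c k := if unpickle k is Some a then - S a / g l a else 0.
  have [x xI xc] := avoid_centers c; exists x; split=> // a.
  have := xc (pickle a); rewrite /c pickleK.
  have [->|g0] := eqVneq (g l a) 0; first by rewrite normr0 mul0r.
  move=> H; apply: le_trans (ler_wpM2l _ H) _ => //.
  by rewrite -normrM mulrBr mulrCA mulfV// mulr1 opprK mulrC.
pose S := fix S l : A -> R :=
  if l is l'.+1 then fun a => sval (step l' (S l')) * g l' a + S l' a else b.
pose t l := sval (step l (S l)).
have SE l a : S l a = \sum_(i < l) t i * g i a + b a.
  elim: l => [|l IH]; first by rewrite big_ord0 add0r.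
  by rewrite big_ord_recr /= IH addrA [t l * _ + _]addrC.
exists t => [l|l a]; rewrite ?/t; first by case: (svalP (step l (S l))).
by rewrite big_ord_recr /= addrAC -SE addrC; case: (svalP (step l (S l))).
Qed.

Lemma generic_coefficients (I : finType) (A : countType) (g : I -> A -> R)
    (b : A -> R) :
  exists2 t : I -> R, forall p, 1 <= t p <= 2 &
    forall a p, g p a != 0 -> exists2 q, g q a != 0 &
      `|g q a| * gap (pickle a) <= `|\sum_p t p * g p a + b a|.
Proof.
pose g' (l : nat) a := if insub l is Some i then g (enum_val (i : 'I_#|I|)) a else 0.
have [t t12 tg] := generic_coefficients_seq g' b.
have g'E (i : 'I_#|I|) a : g' i a = g (enum_val i) a by rewrite /g' valK.
exists (fun p => t (enum_rank p)) => // a p gp.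
have ex : exists l, g' l a != 0.
  by exists (enum_rank p); rewrite g'E enum_rankK.
have bd l : g' l a != 0 -> (l <= #|I|)%N.
  by rewrite /g'; case: insubP => [i lI _ _|]; [exact: ltnW|rewrite eqxx].
case: (ex_maxnP ex bd) => l gl lmax.
have lI : (l < #|I|)%N.
  by move: gl; rewrite /g'; case: insubP => //; rewrite eqxx.
exists (enum_val (Ordinal lI)); rewrite -?g'E//.
apply: le_trans (tg l a) _; rewrite le_eqVlt; apply/orP; left; apply/eqP.
congr (`| _ + _ |).
have -> : \sum_p t (enum_rank p) * g p a = \sum_(i < #|I|) t i * g' i a.
  rewrite (reindex (@enum_val I predT)) /=; last exact/onW_bij/enum_val_bij.
  by apply: eq_bigr => i _; rewrite enum_valK g'E.
rewrite (big_ord_widen _ (fun i => t i * g' i a) lI) big_mkcond /=.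
apply: eq_bigr => i _; case: ifPn => //; rewrite -leqNgt => li.
have [->|/lmax] := eqVneq (g' i a) 0; first by rewrite mulr0.
by rewrite leqNgt li.
Qed.

End RealNumbers.

Section SingularTriple.
Context {R : realType}.

(* al and be are lacunary sums of 1 / Q_k over the k of one parity each, so that
   the partial sum of al or be at k is good until Q_(k+1), where the other takes over. *)
Lemma singular_triple (F : nat -> nat) : exists al be : R,
  [/\ 0 <= al <= 1, 0 <= be <= 1,
      forall a b c : int, a%:~R + b%:~R * al + c%:~R * be = 0 ->
        [/\ a = 0, b = 0 & c = 0] &
      forall X, (0 < X)%N -> exists a b c : int,
        [/\ (`|a| <= X)%N /\ (`|b| <= X)%N /\ (`|c| <= X)%N,
            [|| a != 0, b != 0 | c != 0] &
            `|a%:~R + b%:~R * al + c%:~R * be| * (F X)%:R <= 1]].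
Proof.
pose F' X := (\sum_(i < X.+1) F i)%N.
have F'le X Y : (X <= Y)%N -> (F X <= F' Y)%N.
  by move=> XY; rewrite /F' (bigD1 (inord X)) //= inordK ?leq_addr.
pose Q := fix Q k := if k is k'.+1 then (Q k' * (2 * F' (Q k') + Q k' + 2))%N else 1%N.
have QS k : Q k.+1 = (Q k * (2 * F' (Q k) + Q k + 2))%N by [].
have Qgt k : (k < Q k)%N by elim: k => // k IH; rewrite QS; nia.
have Q0 k : 0 < (Q k)%:R :> R by rewrite ltr0n; have := Qgt k; lia.
have Q2 k : 2 * (Q k)%:R <= (Q k.+1)%:R :> R.
  by rewrite -natrM ler_nat QS; nia.
have Q00 : Q 0%N = 1%N by [].
clearbody Q.
pose s (e : bool) j : R := if odd j == e then (Q j.+1)%:R^-1 else 0.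
pose u e k : R := \sum_(j < k) s e j.
pose d k : R := 2 / (Q k.+1)%:R.
have uS e k : u e k.+1 = u e k + s e k by rewrite /u big_ord_recr.
have s0 e j : 0 <= s e j <= (Q j.+1)%:R^-1.
  by rewrite /s; have := Q0 j.+1; rewrite -invr_gt0; case: ifP => _ ?; lra.
have dS k : d k.+1 <= (Q k.+1)%:R^-1.
  by rewrite /d ler_pdivrMr// mulrC ler_pdivlMr//; exact: Q2.
have d0 k : 0 <= d k by rewrite divr_ge0.
have /choice[l ul] (e : bool) : exists le, forall k, u e k <= le <= u e k + d k.
  apply: nested_limit => // k; rewrite uS; first by have := s0 e k; lra.
  by have := s0 e k; have := dS k; rewrite {3}/d; lra.
have uint e k : exists p : int, (Q k)%:R * u e k = p%:~R.
  elim: k => [|k [p IH]]; first by exists 0; rewrite /u big_ord0 mulr0.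
  exists ((2 * F' (Q k) + Q k + 2)%:Z * p + (odd k == e)%:Z).
  rewrite uS mulrDr rmorphD rmorphM /= -IH {1}QS natrM; congr (_ + _).
    by rewrite mulrCA mulrA -!pmulrn.
  by rewrite /s; case: ifP => _; rewrite ?mulfV ?gt_eqF ?mulr0.
have l01 e : 0 <= l e <= 1.
  have := ul e 0%N; rewrite /u big_ord0 add0r /d.
  suff : 2 / (Q 1%N)%:R <= 1 :> R by lra.
  by rewrite ler_pdivrMr// mul1r ler_nat; have := Qgt 1%N; lia.
exists (l false), (l true); split=> //.
- move=> a b c abc.
  pose S k : R := a%:~R + b%:~R * u false k + c%:~R * u true k.
  pose B := (2 * (`|b| + `|c|))%N.
  have S0 k : (B <= k)%N -> S k = 0.
    move=> Bk; have [p pE] := uint false k; have [q qE] := uint true k.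
    have Sint : (Q k)%:R * S k = ((Q k)%:Z * a + b * p + c * q)%:~R.
      by rewrite !rmorphD !rmorphM /= -pE -qE /S -!pmulrn; ring.
    have Ssmall : `|(Q k)%:R * S k| < 1.
      rewrite normrM (gtr0_norm (Q0 k)).
      have -> : S k = b%:~R * (u false k - l false) + c%:~R * (u true k - l true).
        by rewrite -[LHS]subr0 -abc /S; ring.
      apply: le_lt_trans (_ : (Q k)%:R * (`|b|%N%:R * d k + `|c|%N%:R * d k) < 1).
        apply: ler_wpM2l => //; apply: le_trans (ler_normD _ _) _.
        by rewrite !normrM -!intr_norm -!natr_absz lerD// ler_wpM2l// ler_norml;
          [have := ul false k|have := ul true k]; lra.
      rewrite -mulrDl -natrD /d !mulrA ltr_pdivrMr// mul1r -!natrM ltr_nat QS.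
      by move: Bk; rewrite /B; have := Qgt k; nia.
    move: Ssmall; rewrite Sint -intr_norm -[1]/(1%:~R) ltr_int.
    move=> lt1; have : (Q k)%:R * S k == 0.
      by rewrite Sint intr_eq0; lia.
    by rewrite mulf_eq0 gt_eqF//= => /eqP.
  have bc k : (B <= k)%N -> b%:~R * s false k + c%:~R * s true k = 0.
    move=> Bk; have := S0 _ Bk; have := S0 _ (leqW Bk).
    by rewrite /S !uS !mulrDr; lra.
  have Q'0 k : ((Q k)%:R^-1 == 0 :> R) = false by rewrite invr_eq0 gt_eqF.
  have BB : (B <= B.*2)%N by rewrite -addnn leq_addr.
  have b0 : b = 0.
    have /eqP := bc _ BB; rewrite /s odd_double /= mulr0 addr0.
    by rewrite mulf_eq0 Q'0 orbF intr_eq0 => /eqP.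
  have c0 : c = 0.
    have /eqP := bc _ (leqW BB); rewrite /s /= odd_double /= mulr0 add0r.
    by rewrite mulf_eq0 Q'0 orbF intr_eq0 => /eqP.
  split=> //; move: abc; rewrite b0 c0 !mul0r !addr0 => /eqP.
  by rewrite intr_eq0 => /eqP.
- move=> X X0.
  have [||k QX kmax] := @ex_maxnP (fun k => Q k <= X)%N X.
  - by exists 0%N; rewrite Q00.
  - by move=> k QX; apply: leq_trans QX; exact: ltnW.
  have XQ : (X < Q k.+1)%N by rewrite ltnNge; apply/negP => /kmax; rewrite ltnn.
  pose e := ~~ odd k; have [p pE] := uint e k.
  have ue : u e k.+1 = u e k by rewrite uS /s /e; case: odd; rewrite addr0.
  have lk := ul e k; have lk1 : l e <= u e k + d k.+1.
    by have := ul e k.+1; rewrite ue; lra.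
  have small : `|- p%:~R + (Q k)%:R * l e| * (F X)%:R <= 1.
    have -> : - p%:~R + (Q k)%:R * l e = (Q k)%:R * (l e - u e k).
      by rewrite -pE; ring.
    rewrite ger0_norm ?mulr_ge0//; last lra.
    apply: (@le_trans _ _ ((Q k)%:R * d k.+1 * (F' (Q k.+1))%:R)).
      rewrite ler_pM ?ler0n ?mulr_ge0 ?ler_nat ?F'le 1?ltnW//; first lra.
      by rewrite ler_wpM2l//; lra.
    rewrite /d mulrA mulrAC ler_pdivrMr// mul1r -!natrM ler_nat (QS k.+1).
    by move: QX XQ; nia.
  have u0 : 0 <= u e k by apply: sumr_ge0 => j _; case/andP: (s0 e j).
  have pX : (`|- p| <= X)%N.
    have : `|p|%N%:R <= (Q k)%:R :> R.
      rewrite natr_absz intr_norm -pE ger0_norm ?mulr_ge0//.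
      by rewrite ler_piMr//; have := l01 e; lra.
    by rewrite ler_nat; lia.
  have QN0 : (Q k)%:Z != 0 by have := Qgt k; lia.
  exists (- p); move: small; rewrite /e; case: odd => /= small.
  + by exists (Q k)%:Z, 0; rewrite QN0 orbT mul0r addr0 rmorphN.
  + by exists 0, (Q k)%:Z; rewrite QN0 !orbT mul0r addr0 rmorphN.
Qed.

End SingularTriple.

Lemma increasing_enumeration (P : nat -> Prop) :
    (forall H, exists2 h, (H <= h)%N & P h) ->
  exists f : nat -> nat, [/\ forall k, (f k < f k.+1)%N, forall k, P (f k) &
    forall h, P h -> exists k, h = f k].
Proof.
move=> Pinf.
have /choice[g gP] (H : nat) : exists h, [/\ (H <= h)%N, P h &
    forall h', (H <= h')%N -> P h' -> (h <= h')%N].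
  have ex : exists h, `[< (H <= h)%N /\ P h >].
    by have [h Hh Ph] := Pinf H; exists h; apply/asboolP.
  case: (ex_minnP ex) => h /asboolP[Hh Ph] hmin.
  by exists h; split=> // h' Hh' Ph'; apply: hmin; apply/asboolP.
pose f := fix f k := g (if k is k'.+1 then (f k').+1 else 0%N).
have fS k : (f k < f k.+1)%N by case: (gP (f k).+1).
exists f; split=> [//|[|k]|h Ph]; [by case: (gP 0%N)|by case: (gP (f k).+1)|].
apply: contrapT => nf.
have flt k : (f k < h)%N.
  rewrite ltn_neqAle; apply/andP; split.
    by apply/eqP => fk; apply: nf; exists k.
  elim: k => [|k IH]; first by case: (gP 0%N) => _ _; exact.
  case: (gP (f k).+1) => _ _; apply=> //; rewrite ltn_neqAle IH andbT.
  by apply/eqP => fk; apply: nf; exists k.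
have fge k : (k <= f k)%N by elim: k => // k /leq_ltn_trans; exact.
by have := flt h; rewrite ltnNge fge.
Qed.

Section Height.
Variable m : nat.
Implicit Types x : 'rV[int]_m.

Lemma absz_le_height x i : (`|x 0%R i| <= height x)%N.
Proof. exact: (@leq_bigmax_cond _ predT (fun i => absz (x ord0 i))). Qed.

Lemma height_leP x h : reflect (forall i, (`|x 0%R i| <= h)%N) (height x <= h)%N.
Proof.
apply: (iffP (bigmax_leqP _ _ _)) => [H i|H i _]; first exact: H.
exact: H.
Qed.

Lemma height_gt0 x : (0 < height x)%N = (x != 0).
Proof.
apply/idP/idP => [|x0]; last first.
  rewrite lt0n; apply: contraNneq x0 => hx; apply/eqP/rowP => i; rewrite mxE.
  by apply/eqP; rewrite -absz_eq0 -leqn0; apply: leq_trans (absz_le_height x i) _; rewrite hx.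
by apply: contraTneq => ->; rewrite -leqNgt; apply/height_leP => i; rewrite mxE.
Qed.

Lemma heightN x : height (- x) = height x.
Proof. by apply: eq_bigr => i _; rewrite mxE abszN. Qed.

Lemma height_box h : exists s : seq 'rV[int]_m, forall x, (height x <= h)%N -> x \in s.
Proof.
exists [seq \row_i ((f i : nat)%:Z - h%:Z) | f : {ffun 'I_m -> 'I_(2 * h).+1}].
move=> x /height_leP xh; apply/mapP.
exists [ffun i => inord (absz (x 0%R i + h%:Z))]; first by rewrite mem_enum.
apply/rowP => i; rewrite !mxE ffunE; have := xh i => xhi.
by move: xhi; move: (x _ i) => v vh; rewrite inordK; lia.
Qed.

End Height.

Section DistInt.
Context {R : realType}.

Lemma dist_int_le (t : R) k : dist_int t <= `|t + k%:~R|.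
Proof.
apply: ge_inf; first by exists 0 => _ [i _ <-].
by exists (- k) => //; rewrite rmorphN opprK.
Qed.

Lemma dist_int_attained (t : R) : exists k, dist_int t = `|t + k%:~R|.
Proof.
exists (- Num.floor (t + 2^-1)); apply/eqP; rewrite eq_le dist_int_le /=.
apply: lb_le_inf; first by exists `|t - 0%:~R|; exists 0.
move=> _ [k _ <-]; set f := Num.floor _.
have /andP[fl fu] : f%:~R <= t + 2^-1 < (f + 1)%:~R.
  by rewrite -floor_eq.
have [->|kf] := eqVneq k f; first by rewrite rmorphN.
move: fu; rewrite rmorphN rmorphD /= => fu.
have : (k + 1)%:~R <= f%:~R :> R \/ (f + 1)%:~R <= k%:~R :> R.
  by rewrite !ler_int !lezD1; apply/orP; rewrite -neq_lt.
move=> fk; apply: (@le_trans _ _ 2^-1); first by rewrite ler_norml; lra.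
by move: fk; rewrite !rmorphD ler_normr /=; case=> H; lra.
Qed.

Lemma dist_int_ge0 (t : R) : 0 <= dist_int t.
Proof. by have [k ->] := dist_int_attained t. Qed.

End DistInt.

Section BestApproximation.
Context {R : realType} {m n : nat}.
Variable Theta : 'M[R]_(n, m).
Implicit Types x : 'rV[int]_m.

Lemma dist_int_le_zeta j x : dist_int (linform Theta j x) <= zeta Theta x.
Proof. exact: (le_bigmax _ (fun j => dist_int (linform Theta j x))). Qed.

Lemma zeta_le c x : 0 <= c -> (forall j, dist_int (linform Theta j x) <= c) ->
  zeta Theta x <= c.
Proof. by move=> c0 H; apply: bigmax_le. Qed.

Lemma zeta_attained x : (0 < n)%N ->
  exists j, zeta Theta x = dist_int (linform Theta j x).
Proof.
move=> n0; eexists; apply: (bigmax_eq_arg _ (Ordinal n0) predT) => // j _.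
exact: dist_int_ge0.
Qed.

Lemma zeta_ge0 x : 0 <= zeta Theta x.
Proof. exact: bigmax_ge_id. Qed.

Lemma linform_delta j x :
  \sum_(k < n) \sum_(i < m) ((delta_mx j (0 : 'I_1) *m x) k i)%:~R * Theta k i =
  linform Theta j x.
Proof.
rewrite (bigD1 j) //= [X in _ + X]big1 ?addr0 => [|k kj].
  by apply: eq_bigr => i _; rewrite mulrC mxE big_ord1 !mxE !eqxx mul1r.
by apply: big1 => i _; rewrite mxE big_ord1 !mxE (negPf kj) !mul0r.
Qed.

Lemma linform_eq0 j : linform Theta j 0 = 0.
Proof. by apply: big1 => i _; rewrite mxE mulr0. Qed.

Lemma zeta0 : zeta Theta 0 = 0.
Proof.
apply/eqP; rewrite eq_le zeta_ge0 andbT; apply: zeta_le => // j.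
by apply: le_trans (dist_int_le _ 0) _; rewrite linform_eq0 addr0 normr0.
Qed.

Lemma exists_best_approx x0 h : x0 != 0 -> (height x0 <= h)%N ->
  exists x, [/\ best_approx Theta x, (height x <= h)%N & zeta Theta x <= zeta Theta x0].
Proof.
move=> x00 x0h; have [s sP] := height_box m h.
pose good x := (x != 0) && (height x <= h)%N.
have [x [xg xmin]] : exists x, good x /\ forall x', good x' -> zeta Theta x <= zeta Theta x'.
  suff [x [xg xmin]] : exists x, good x /\
      forall x', x' \in s -> good x' -> zeta Theta x <= zeta Theta x'.
    by exists x; split=> // x' x'g; apply: xmin => //; apply/sP; case/andP: x'g.
  elim: s {sP} => [|y s [x [xg xmin]]]; first by exists x0; rewrite /good x00.
  have [/andP[yg yx]|H] := boolP (good y && (zeta Theta y <= zeta Theta x)).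
    exists y; split=> // x'; rewrite inE => /predU1P[->//|x's] x'g.
    exact: le_trans yx (xmin _ x's x'g).
  exists x; split=> // x'; rewrite inE => /predU1P[->|x's] x'g; last exact: xmin.
  by move: H; rewrite x'g /= -ltNge => /ltW.
exists x; case/andP: xg => xn0 xh; split=> //; last by apply: xmin; rewrite /good x00.
split=> // x' x'n0 x'x; apply: xmin; rewrite /good x'n0.
exact: leq_trans xh.
Qed.

Section Free.
Hypotheses (n0 : (0 < n)%N) (free : entries_and_1_free Theta).

Lemma zeta_inj x x' : zeta Theta x = zeta Theta x' -> x = x' \/ x = - x'.
Proof.
have [j ->] := zeta_attained x n0; have [j' ->] := zeta_attained x' n0.
have [k ->] := dist_int_attained (linform Theta j x).
have [k' ->] := dist_int_attained (linform Theta j' x').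
move=> /eqP; rewrite eqr_norm2 => E.
have {}E : exists s : bool,
    linform Theta j x + k%:~R = (-1) ^+ s * (linform Theta j' x' + k'%:~R).
  by case/orP: E => /eqP ->; [exists false|exists true];
    rewrite ?expr0 ?expr1 ?mul1r ?mulN1r.
move: E => [s E].
have [] := free (a := delta_mx j (0 : 'I_1) *m x - (-1) ^+ s *: (delta_mx j' (0 : 'I_1) *m x'))
  (b := k - (-1) ^+ s * k').
  rewrite rmorphB rmorphM /= rmorph_sign.
  transitivity (linform Theta j x - (-1) ^+ s * linform Theta j' x' +
      (k%:~R - (-1) ^+ s * k'%:~R)); last first.
    by rewrite addrACA -opprD -mulrDr E subrr.
  congr (_ + _); rewrite -2!linform_delta mulr_sumr -sumrB; apply: eq_bigr => u _.
  rewrite mulr_sumr -sumrB; apply: eq_bigr => v _.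
  by rewrite mxE [X in _ + X]mxE [X in _ - X]mxE rmorphB rmorphM /= rmorph_sign mulrBl mulrA.
move=> /matrixP a0 _.
have {}a0 u v : (u == j)%:R * x 0 v = (-1) ^+ s * ((u == j')%:R * x' 0 v).
  have := a0 u v; rewrite !mxE !big_ord1 !mxE !eqxx !andbT.
  by move/eqP; rewrite subr_eq0 => /eqP.
have [jj'|jj'] := eqVneq j j'.
  have {}a0 v : x 0 v = (-1) ^+ s * x' 0 v by have := a0 j v; rewrite jj' eqxx !mul1r.
  case: s {E} a0 => a0; [right|left]; apply/rowP => v; rewrite ?mxE a0.
    by rewrite expr1 mulN1r.
  by rewrite expr0 mul1r.
left; apply/rowP => v; have := a0 j v; have := a0 j' v.
rewrite !eqxx (negPf jj') eq_sym (negPf jj') !mul0r !mul1r mulr0 => /esym/eqP.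
by rewrite mulf_eq0 signr_eq0 /= => /eqP -> ->.
Qed.

Lemma zeta_gt0 x : x != 0 -> 0 < zeta Theta x.
Proof.
move=> x0; rewrite lt_neqAle zeta_ge0 andbT; apply: contraNneq x0 => zx.
by have [] := @zeta_inj x 0; rewrite ?zeta0// ?oppr0 => ->.
Qed.

Lemma best_approx_height_inj x x' : best_approx Theta x -> best_approx Theta x' ->
  height x = height x' -> x = x' \/ x = - x'.
Proof.
move=> [x0 xb] [x'0 x'b] hx; apply: zeta_inj.
by apply/eqP; rewrite eq_le xb ?x'b// hx.
Qed.

Lemma exists_ext_best_approx_seq :
    (forall e, 0 < e -> exists2 x, x != 0 & zeta Theta x < e) ->
  exists z : nat -> 'rV[int]_(m + n), ext_best_approx_seq Theta z.
Proof.
move=> small.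
pose P h := exists2 x, best_approx Theta x & height x = h.
have [H|f [fS fP fall]] := @increasing_enumeration P.
  have [s sP] := height_box m H.
  have [e e0 es] : exists2 e, 0 < e & forall x, x \in s -> x != 0 -> e <= zeta Theta x.
    elim: s {sP} => [|y s [e e0 es]]; first by exists 1.
    have [y0|y0] := eqVneq y 0.
      by exists e => // x; rewrite inE y0 => /predU1P[->|/es//]; rewrite eqxx.
    exists (Num.min e (zeta Theta y)); first by rewrite lt_min e0 zeta_gt0.
    move=> x; rewrite inE ge_min => /predU1P[->|/es H1 /H1 ->//].
    by rewrite lexx orbT.
  have [x x0 xe] := small e e0.
  have [x' [x'b _ x'x]] := exists_best_approx x0 (leqnn _).
  exists (height x'); last by exists x'.
  rewrite leqNgt; apply/negP => /ltnW/sP/es; rewrite leNgt.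
  by rewrite (le_lt_trans x'x xe) => /(_ (proj1 x'b)).
have /choice[z zP] nu : exists z : 'rV[int]_(m + n),
    [/\ best_approx Theta (lsubmx z), height (lsubmx z) = f nu &
      forall j, `|linform Theta j (lsubmx z) + (rsubmx z 0 j)%:~R|
        = dist_int (linform Theta j (lsubmx z))].
  have [x xb xh] := fP nu.
  have /choice[y yP] j := dist_int_attained (linform Theta j x).
  by exists (row_mx x (\row_j y j)); rewrite row_mxKl row_mxKr; split=> // j; rewrite mxE -yP.
exists z; split=> [nu|nu|x xb|nu]; [by case: (zP nu)| |..].
- by case: (zP nu) (zP nu.+1) => _ -> _ [_ -> _].
- have [|nu hx] := fall (height x); first by exists x.
  exists nu; apply: best_approx_height_inj => //; first by case: (zP nu).
  by case: (zP nu) => _ ->.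
- by case: (zP nu).
Qed.

End Free.

Lemma ext_best_approx_seq_height_mono z mu nu : ext_best_approx_seq Theta z ->
  (mu < nu)%N -> (height (lsubmx (z mu)) < height (lsubmx (z nu)))%N.
Proof.
move=> zb; elim: nu => // nu IH; rewrite ltnS leq_eqVlt => /predU1P[->|/IH H].
  exact: ebas_incr zb nu.
exact: ltn_trans H (ebas_incr zb nu).
Qed.

Lemma ext_best_approx_seq_le z nu x : ext_best_approx_seq Theta z -> x != 0 ->
  (height x < height (lsubmx (z nu.+1)))%N -> zeta Theta (lsubmx (z nu)) <= zeta Theta x.
Proof.
move=> zb x0 xh; rewrite leNgt; apply/negP => xz.
have [x' [x'b x'h x'x]] := exists_best_approx x0 (leqnn _).
have zx' : (height (lsubmx (z nu)) < height x')%N.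
  rewrite ltnNge; apply/negP => /(proj2 (ebas_best zb nu) _ (proj1 x'b)).
  by rewrite leNgt (le_lt_trans x'x xz).
have x'z := leq_ltn_trans x'h xh.
have [k xk] := ebas_all zb x'b.
have {xk} hk : height x' = height (lsubmx (z k)) by case: xk => ->; rewrite ?heightN.
rewrite !hk in zx' x'z; have [kn|kn] := leqP k nu.
  move: zx'; rewrite ltnNge; move: kn; rewrite leq_eqVlt => /predU1P[->|]; first by rewrite leqnn.
  by move=> /(ext_best_approx_seq_height_mono zb)/ltnW ->.
move: x'z; rewrite ltnNge; move: kn; rewrite leq_eqVlt => /predU1P[->|]; first by rewrite leqnn.
by move=> /(ext_best_approx_seq_height_mono zb)/ltnW ->.
Qed.

End BestApproximation.

Section Construction.
Context {R : realType}.

Definition ternary_form (w : 'I_3 -> R) (c : 'rV[int]_3) : R :=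
  \sum_k w k * (c 0 k)%:~R.

Lemma singular_form (F : nat -> nat) : exists w : 'I_3 -> R,
  [/\ forall k, 0 <= w k <= 1, forall c, ternary_form w c = 0 -> c = 0 &
      forall X, (0 < X)%N -> exists c,
        [/\ c != 0, (height c <= X)%N & `|ternary_form w c| * (F X)%:R <= 1]].
Proof.
have [al [be [al01 be01 free sing]]] := @singular_triple R F.
pose v3 T (a b c : T) (k : 'I_3) := nth a [:: a; b; c] k.
have k3 (P : 'I_3 -> Prop) : P ord0 -> P (inord 1) -> P (inord 2) -> forall k, P k.
  move=> P0 P1 P2 [[|[|[|//]]] k].
  - by rewrite (_ : Ordinal k = ord0)//; apply: val_inj.
  - by rewrite (_ : Ordinal k = inord 1)//; apply: val_inj; rewrite /= inordK.
  - by rewrite (_ : Ordinal k = inord 2)//; apply: val_inj; rewrite /= inordK.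
have formE c : ternary_form (v3 R 1 al be) c =
    (c 0 ord0)%:~R + (c 0 (inord 1))%:~R * al + (c 0 (inord 2))%:~R * be.
  rewrite /ternary_form !big_ord_recl big_ord0 addr0 addrA mul1r.
  rewrite -[lift ord0 (lift _ _)](inord_val) -[lift ord0 ord0](inord_val) /=.
  by rewrite /v3 !inordK//= ![_ * (_)%:~R]mulrC.
exists (v3 R 1 al be); split=> [|c|X X0].
- by apply: k3; rewrite /v3 ?inordK//= ler01 lexx.
- rewrite formE => /free[c0 c1 c2]; apply/rowP; apply: k3; by rewrite mxE.
have [a [b [c [[aX [bX cX]] abc small]]]] := sing X X0.
exists (\row_k v3 _ a b c k); split.
- move: abc; apply: contraTneq => /rowP abc0.
  have := abc0 ord0; have := abc0 (inord 1); have := abc0 (inord 2).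
  by rewrite !mxE /v3 !inordK//= => -> -> ->; rewrite eqxx.
- by apply/height_leP; apply: k3; rewrite mxE /v3 ?inordK.
- by rewrite formE !mxE /v3 !inordK.
Qed.

Context {m n : nat}.
Implicit Types (w : 'I_3 -> R) (lam : 'I_n -> R) (t : 'I_n * 'I_m -> R)
  (x : 'rV[int]_(3 + m)).

Definition theta_mx w lam t : 'M[R]_(n, 3 + m) :=
  \matrix_(j, i) match fintype.split i with inl k => lam j * w k | inr i' => t (j, i') end.

Lemma sum_theta w lam t j x :
  \sum_i (x 0 i)%:~R * theta_mx w lam t j i =
  lam j * ternary_form w (lsubmx x) + \sum_i t (j, i) * (rsubmx x 0 i)%:~R.
Proof.
rewrite big_split_ord /= mulr_sumr; congr (_ + _); apply: eq_bigr => i _.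
  by rewrite !mxE (unsplitK (inl i)) mulrC mulrA.
by rewrite !mxE (unsplitK (inr i)) mulrC.
Qed.

Lemma linform_theta w lam t j x : linform (theta_mx w lam t) j x =
  lam j * ternary_form w (lsubmx x) + \sum_i t (j, i) * (rsubmx x 0 i)%:~R.
Proof. by rewrite -sum_theta; apply: eq_bigr => i _; rewrite mulrC. Qed.

Definition form_index j x (y : int) : 'M[int]_(n, 3 + m) * int :=
  (delta_mx j (0 : 'I_1) *m x, y).

Lemma exists_generic_theta w : (forall c, ternary_form w c = 0 -> c = 0) ->
  exists lam t,
  [/\ forall j, 1 <= lam j <= 2, forall p, 1 <= t p <= 2,
      entries_and_1_free (theta_mx w lam t) &
      forall j x y, (rsubmx x != 0) || (y != 0) ->
        gap (pickle (form_index j x y)) / 4 <=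
          `|linform (theta_mx w lam t) j x + y%:~R| ].
Proof.
move=> wfree.
pose A := ('M[int]_(n, 3 + m) * int)%type.
pose g1 (j : 'I_n) (a : A) := ternary_form w (lsubmx (row j a.1)).
have [lam lam12 lamP] := generic_coefficients g1 (fun a => a.2%:~R).
pose g2 (p : 'I_n * 'I_m) (a : A) : R := (rsubmx a.1 p.1 p.2)%:~R.
have [t t12 tP] := generic_coefficients g2
  (fun a => \sum_j lam j * g1 j a + a.2%:~R).
have formE (a : A) :
    \sum_j \sum_i (a.1 j i)%:~R * theta_mx w lam t j i + a.2%:~R =
    \sum_p t p * g2 p a + (\sum_j lam j * g1 j a + a.2%:~R).
  have -> : \sum_p t p * g2 p a = \sum_j \sum_i t (j, i) * g2 (j, i) a.
    by rewrite pair_bigA; apply: eq_bigr => -[].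
  rewrite addrA -big_split /=.
  congr (_ + _); apply: eq_bigr => j _.
  transitivity (\sum_i (row j a.1 0 i)%:~R * theta_mx w lam t j i).
    by apply: eq_bigr => i _; rewrite [in RHS]mxE.
  rewrite sum_theta addrC; congr (_ + _); apply: eq_bigr => i _.
  by rewrite /g2 !mxE.
have rsub0 (a : A) : rsubmx a.1 != 0 -> exists p, g2 p a != 0.
  move=> a0; apply: contrapT => H; move/eqP: a0; apply; apply/matrixP => j i.
  rewrite [RHS]mxE; apply: contrapT => /eqP aji; apply: H.
  by exists (j, i); rewrite /g2 intr_eq0.
have rsub_large (a : A) : rsubmx a.1 != 0 -> gap (pickle a) <=
    `|\sum_j \sum_i (a.1 j i)%:~R * theta_mx w lam t j i + a.2%:~R|.
  move=> /rsub0[p /tP[q qa]]; rewrite formE; apply: le_trans.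
  rewrite ler_peMl//; first exact/ltW/gap_gt0.
  by rewrite /g2 -intr_norm -[1]/(1%:~R) ler_int; move: qa; rewrite intr_eq0; lia.
have form0 (a : A) : rsubmx a.1 = 0 ->
    \sum_j \sum_i (a.1 j i)%:~R * theta_mx w lam t j i + a.2%:~R =
    \sum_j lam j * g1 j a + a.2%:~R.
  move=> a0; rewrite formE big1 ?add0r// => p _.
  by rewrite /g2 a0 mxE mulr0.
exists lam, t; split=> // [a b ab|j x y xy].
  have [a0|a0] := eqVneq (rsubmx a) 0; last first.
    have := @rsub_large (a, b) a0; rewrite ab normr0 leNgt.
    by rewrite gap_gt0.
  have := @form0 (a, b) a0; rewrite ab /= => /esym gb.
  have g0 j : g1 j (a, b) = 0.
    apply: contrapT => /eqP /lamP[q q0]; rewrite gb normr0 leNgt.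
    by rewrite mulr_gt0 ?normr_gt0 ?gap_gt0.
  split.
    rewrite -[a]hsubmxK a0; apply/matrixP => j i.
    have /rowP := wfree _ (g0 j); rewrite mxE [RHS]mxE.
    by case: fintype.split => k; rewrite ?mxE// => /(_ k); rewrite !mxE.
  move: gb; rewrite big1 => [|j _]; last by rewrite g0 mulr0.
  by rewrite add0r => /eqP; rewrite intr_eq0 => /eqP.
set a : A := form_index j x y.
have -> : linform (theta_mx w lam t) j x + y%:~R =
    \sum_j \sum_i (a.1 j i)%:~R * theta_mx w lam t j i + a.2%:~R.
  by rewrite linform_delta.
have gap4 : gap (pickle a) / 4 <= gap (pickle a) :> R.
  by have := gap_gt0 (R := R) (pickle a); lra.
have [a0|a0] := eqVneq (rsubmx a.1) 0; last exact: le_trans gap4 (rsub_large _ a0).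
have x0 : rsubmx x = 0.
  apply/rowP => i; have /matrixP/(_ j i) := a0; rewrite !mxE big_ord1 !mxE.
  by rewrite !eqxx mul1r.
rewrite x0 eqxx /= in xy; rewrite form0//.
have rowk k : row k a.1 = (k == j)%:R *: x.
  by apply/rowP => i; rewrite !mxE big_ord1 !mxE eqxx andbT.
have gj : g1 j a = ternary_form w (lsubmx x) by rewrite /g1 rowk eqxx scale1r.
have gk k : k != j -> g1 k a = 0.
  move=> /negPf kj; rewrite /g1 rowk kj scale0r; apply: big1 => i _.
  by rewrite !mxE mulr0.
have sumE : \sum_k lam k * g1 k a = lam j * g1 j a.
  by rewrite (bigD1 j) //= big1 ?addr0// => k /gk ->; rewrite mulr0.
have y1 : 1 <= `|y%:~R| :> R.
  by rewrite -intr_norm -[1]/(1%:~R) ler_int; move: xy; lia.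
have [small|big] := leP `|g1 j a| 4^-1.
  rewrite sumE; apply: (@le_trans _ _ 2^-1).
    by have := gap_le6 (R := R) (pickle a); lra.
  have : `|lam j * g1 j a| <= 2^-1.
    rewrite normrM; have := lam12 j => lamj; rewrite ger0_norm; last lra.
    have -> : 2^-1 = 2 * 4^-1 :> R by lra.
    by rewrite ler_pM//; lra.
  have := ler_normB (lam j * g1 j a + y%:~R) (lam j * g1 j a).
  by rewrite addrAC subrr add0r /=; lra.
have gj0 : g1 j a != 0 by rewrite -normr_gt0; apply: lt_trans big; lra.
have [q qa] := lamP a j gj0; apply: le_trans.
have -> : q = j by apply: contraNeq qa => /gk ->.
by rewrite mulrC ler_pM2r ?gap_gt0// ltW.
Qed.

Lemma exists_rate : exists F : nat -> nat,
  (forall X, (X.+1 ^ 2 <= F X)%N) /\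
  forall X j x y, (height x <= X)%N -> (`|y| <= 2 * (3 + m) * X + 2)%N ->
    2 < gap (pickle (form_index j x y)) / 4 * (F X)%:R :> R.
Proof.
suff /choice[F FP] (X : nat) : exists N, (X.+1 ^ 2 <= N)%N /\
    forall j x y, (height x <= X)%N -> (`|y| <= 2 * (3 + m) * X + 2)%N ->
    2 < gap (pickle (form_index j x y)) / 4 * N%:R :> R.
  by exists F; split=> X; case: (FP X).
have [s sP] := height_box (3 + m) X.
have [s' s'P] := height_box 1 (2 * (3 + m) * X + 2).
pose S := [seq form_index p.1 p.2 (fun_of_matrix v 0 0) |
  p <- [seq (j, x) | j <- enum 'I_n, x <- s], v <- s'].
pose K := (\max_(a <- S) pickle a)%N.
pose N := Num.bound (8 / gap K : R).
exists (N + X.+1 ^ 2)%N; split; first exact: leq_addl.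
move=> j x y xX yY.
have jxy : form_index j x y \in S.
  have -> : form_index j x y = form_index (j, x).1 (j, x).2 ((const_mx y : 'rV[int]_1) 0 0).
    by rewrite mxE.
  apply: allpairs_f; first by apply: allpairs_f; [rewrite mem_enum|exact: sP].
  by apply: s'P; apply/height_leP => i; rewrite mxE.
have pK : (pickle (form_index j x y) <= K)%N by exact: leq_bigmax_seq.
have gK := gap_le (R := R) pK; have g0 := gap_gt0 (R := R) K.
have N8 : 8 / gap K < N%:R :> R by apply: archi_boundP; rewrite divr_ge0// ltW.
rewrite ltr_pdivrMr// in N8.
apply: (@lt_le_trans _ _ (gap K / 4 * N%:R)); first by lra.
by rewrite ler_pM ?ler0n ?ler_nat ?leq_addr//; lra.
Qed.

Lemma linform_bound (Theta : 'M[R]_(n, 3 + m)) j x :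
  (forall i, `|Theta j i| <= 2) ->
  `|linform Theta j x| <= (2 * (3 + m) * height x)%:R.
Proof.
move=> T2; apply: le_trans (ler_norm_sum _ _ _) _.
apply: (@le_trans _ _ (\sum_(i < 3 + m) (2 * height x)%:R)).
  apply: ler_sum => i _; rewrite normrM natrM ler_pM//.
  by rewrite -intr_norm -natr_absz ler_nat absz_le_height.
by rewrite sumr_const card_ord -mulrnA ler_nat mulnAC.
Qed.

Lemma exists_degenerate_theta : (0 < n)%N ->
  exists (w : 'I_3 -> R) (lam : 'I_n -> R) (Theta : 'M[R]_(n, 3 + m)),
  [/\ forall c, ternary_form w c = 0 -> c = 0,
      entries_and_1_free Theta,
      (forall j, 1 <= lam j <= 2) /\ forall j x, rsubmx x = 0 ->
        linform Theta j x = lam j * ternary_form w (lsubmx x),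
      forall X, (0 < X)%N -> exists x,
        [/\ x != 0, (height x <= X)%N & zeta Theta x * (X.+1 ^ 2)%:R <= 2] &
      forall x j y, best_approx Theta x ->
        `|linform Theta j x + y%:~R| = dist_int (linform Theta j x) ->
        rsubmx x = 0 /\ y = 0].
Proof.
move=> n0; have [F [F2 Frate]] := exists_rate.
have [w [w01 wfree wsing]] := singular_form F.
have [lam [t [lam12 t12 free large]]] := exists_generic_theta wfree.
set Theta := theta_mx w lam t in free large.
have small X : (0 < X)%N -> exists x,
    [/\ x != 0, (height x <= X)%N & zeta Theta x * (F X)%:R <= 2].
  move=> /wsing[c [c0 cX cF]]; exists (row_mx c 0); split.
  - by apply: contraNneq c0 => /(congr1 lsubmx); rewrite row_mxKl linear0 => ->.
  - apply/height_leP => i; rewrite mxE; case: fintype.split => k; last by rewrite mxE.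
    exact: leq_trans (absz_le_height _ _) cX.
  apply: (@le_trans _ _ (2 * `|ternary_form w c| * (F X)%:R)); last first.
    rewrite -mulrA; move: cF; set u := _ * _; lra.
  rewrite ler_wpM2r//; apply: zeta_le => [|j]; first by rewrite mulr_ge0.
  apply: le_trans (dist_int_le _ 0) _.
  rewrite addr0 linform_theta row_mxKl row_mxKr big1 => [|i _]; last by rewrite mxE mulr0.
  rewrite addr0 normrM ler_wpM2r//; have := lam12 j => lamj.
  by rewrite ger0_norm; lra.
exists w, lam, Theta; split=> //.
- split=> // j x x0; rewrite linform_theta x0 big1 ?addr0// => i _.
  by rewrite mxE mulr0.
- move=> X /small[x [x0 xX xF]]; exists x; split=> //; apply: le_trans xF.
  by rewrite ler_wpM2l ?zeta_ge0// ler_nat.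
move=> x j y [x0 xbest] xy.
have hx : (0 < height x)%N by rewrite height_gt0.
have [x' [x'0 x'x x'F]] := small _ hx.
have xF : `|linform Theta j x + y%:~R| * (F (height x))%:R <= 2.
  apply: le_trans x'F; rewrite ler_wpM2r// xy.
  exact: le_trans (dist_int_le_zeta _ _ _) (xbest _ x'0 x'x).
have ybound : (`|y| <= 2 * (3 + m) * height x + 2)%N.
  rewrite leqNgt; apply/negP => yY.
  have F4 : 4 <= (F (height x))%:R :> R.
    rewrite ler_nat; apply: leq_trans (F2 _); rewrite -[4%N]/(2 ^ 2)%N leq_sqr.
    by rewrite ltnS.
  have Tb : `|linform Theta j x| <= (2 * (3 + m) * height x)%:R.
    apply: linform_bound => i; rewrite mxE; case: fintype.split => k.
      rewrite normrM -[2]mulr1; have := lam12 j; have := w01 k => w1 l1.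
      by rewrite !ger0_norm ?ler_pM//; lra.
    by have := t12 (j, k) => t1; rewrite ger0_norm; lra.
  have y3 : (2 * (3 + m) * height x)%:R + 1 <= `|y%:~R| :> R.
    by rewrite -intr_norm -natr_absz natr1 ler_nat; lia.
  have : 1 <= `|linform Theta j x + y%:~R|.
    have := ler_normB (linform Theta j x + y%:~R) (linform Theta j x).
    by rewrite addrAC subrr add0r /=; lra.
  by move: xF; nra.
suff : ~~ ((rsubmx x != 0) || (y != 0)).
  by rewrite negb_or !negbK => /andP[/eqP -> /eqP ->].
apply/negP => /(large j x y); rewrite leNgt => /negP; apply.
rewrite -(@ltr_pM2r _ (F (height x))%:R); last first.
  by rewrite ltr0n; apply: leq_trans (F2 _); rewrite expn_gt0.
exact: le_lt_trans xF (Frate _ _ _ _ (leqnn _) ybound).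
Qed.

End Construction.

Section LowerBound.
Context {R : realType}.
Implicit Types a b : 'rV[int]_3.

Definition wedge a b i j : int := a 0 i * b 0 j - a 0 j * b 0 i.

Variable w : 'I_3 -> R.
Hypothesis wfree : forall c, ternary_form w c = 0 -> c = 0.

Lemma wedge_neq0 a b : a != 0 -> (height a < height b)%N ->
  `|ternary_form w b| <= `|ternary_form w a| -> exists i j, wedge a b i j != 0.
Proof.
move=> a0 ab wab; apply: contrapT => H.
have ab0 i j : a 0 i * b 0 j = a 0 j * b 0 i.
  by apply/eqP; rewrite -subr_eq0; apply: contrapT => /negP Hij; apply: H; exists i, j.
have la : 0 < `|ternary_form w a|.
  by rewrite normr_gt0; apply: contraNneq a0 => /wfree ->.
move: ab; rewrite ltnNge => /negP; apply; apply/height_leP => j.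
apply: leq_trans (absz_le_height a j).
have E : ternary_form w a * (b 0 j)%:~R = ternary_form w b * (a 0 j)%:~R.
  rewrite /ternary_form !mulr_suml; apply: eq_bigr => i _.
  by rewrite -!mulrA -!rmorphM /= ab0 [_ * b 0 i]mulrC.
rewrite -(ler_nat R) !natr_absz !intr_norm -(ler_pM2l la) -normrM E normrM.
by rewrite ler_wpM2r.
Qed.

Lemma sum_wedge a b j : \sum_i w i * (wedge a b i j)%:~R =
  ternary_form w a * (b 0 j)%:~R - ternary_form w b * (a 0 j)%:~R.
Proof.
rewrite /ternary_form !mulr_suml -sumrB; apply: eq_bigr => i _.
by rewrite rmorphB !rmorphM /=; ring.
Qed.

(* All x mu ^ x mu.+1 would be multiples of the fixed x N ^ x N.+1, bounded from
   below by integrality, while contraction with w makes them small. *)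
Lemma singular_seq_not_coplanar (x : nat -> 'rV[int]_3) (N : nat) (p q : nat -> R) :
    (forall k, x k != 0) -> (forall k, (height (x k) < height (x k.+1))%N) ->
    (forall k, `|ternary_form w (x k.+1)| <= `|ternary_form w (x k)|) ->
    (forall k, `|ternary_form w (x k)| * (height (x k.+1) ^ 2)%:R <= 2) ->
    (forall k i, (N <= k)%N ->
      (x k 0 i)%:~R = p k * (x N 0 i)%:~R + q k * (x N.+1 0 i)%:~R) ->
  False.
Proof.
move=> x0 xS wS wx2 xpq.
have [i0 [j0 w0]] := wedge_neq0 (x0 N) (xS N) (wS N).
set W := wedge (x N) (x N.+1) in w0.
pose c := ternary_form w (\row_i W i j0).
have c0 : 0 < `|c|.
  rewrite normr_gt0; apply: contraNneq w0 => /wfree/rowP/(_ i0).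
  by rewrite !mxE => ->.
pose B := (\sum_i \sum_j `|W i j|)%N.
have WB i j : (`|W i j| <= B)%N.
  by rewrite /B (bigD1 i) //= (bigD1 j) //= -addnA leq_addr.
have hk k : (k < height (x k))%N.
  elim: k => [|k IH]; first by rewrite height_gt0.
  exact: leq_ltn_trans IH (xS k).
pose k := (N + Num.bound (4 * B%:R / `|c|))%N.
pose D := p k * q k.+1 - p k.+1 * q k.
have NK : (N <= k)%N by exact: leq_addr.
have WD i j : (wedge (x k) (x k.+1) i j)%:~R = D * (W i j)%:~R.
  rewrite /W /wedge !rmorphB !rmorphM /=.
  by rewrite !(xpq k)// !(xpq k.+1) ?leqW// /D; ring.
have D1 : 1 <= `|D| * B%:R.
  have [i [j wij]] := wedge_neq0 (x0 k) (xS k) (wS k).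
  apply: (@le_trans _ _ `|D * (W i j)%:~R|).
    by rewrite -WD -intr_norm -[1]/(1%:~R) ler_int; move: wij; lia.
  by rewrite normrM ler_wpM2l// -intr_norm -natr_absz ler_nat.
have DcE : D * c = \sum_i w i * (wedge (x k) (x k.+1) i j0)%:~R.
  rewrite /c /ternary_form mulr_sumr; apply: eq_bigr => i _.
  by rewrite WD mxE; ring.
pose h : R := (height (x k.+1))%:R.
have xh l : `|(x l 0 j0)%:~R| <= (height (x l))%:R :> R.
  by rewrite -intr_norm -natr_absz ler_nat absz_le_height.
have h0 : 0 < h by rewrite ltr0n; apply: leq_ltn_trans (hk _).
have Dc : `|D * c| <= 2 * (`|ternary_form w (x k)| * h).
  rewrite DcE sum_wedge; apply: le_trans (ler_normB _ _) _.
  rewrite !normrM mulr2n mulrDl !mul1r lerD// ler_pM//.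
  apply: le_trans (xh _) _; rewrite ler_nat; exact: ltnW.
have Dch : `|D * c| * h <= 4.
  have := wx2 k; rewrite natrX -/h expr2 mulrA => wh2.
  by apply: (@le_trans _ _ (2 * (`|ternary_form w (x k)| * h) * h)); [rewrite ler_pM2r|lra].
have : 4 * B%:R < h * `|c|.
  rewrite -ltr_pdivrMr//; apply: (@lt_le_trans _ _ (Num.bound (4 * B%:R / `|c|))%:R).
    by apply: archi_boundP; rewrite divr_ge0// mulr_ge0.
  rewrite ler_nat; apply: leq_trans (leq_addl N _) _; apply: ltnW.
  exact: leq_trans (hk k) (ltnW (xS k)).
apply/negP; rewrite -leNgt.
apply: (@le_trans _ _ (`|D * c| * h * B%:R)); last by rewrite ler_wpM2r.
rewrite normrM [leRHS](_ : _ = h * `|c| * (`|D| * B%:R)); last by ring.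
by rewrite ler_peMr// mulr_ge0// ltW.
Qed.

End LowerBound.

Section CoordinateSubspace.
Context {R : realType} {m n : nat}.

Definition coordinate_lattice : set 'rV[int]_(3 + m + n) :=
  [set z | rsubmx (lsubmx z) = 0 /\ rsubmx z = 0].

Lemma int_lattice_coordinate : int_lattice coordinate_lattice.
Proof.
split=> [|u v [u1 u2] [v1 v2]]; first by rewrite /coordinate_lattice /= !linear0.
by rewrite /coordinate_lattice /= !linearB /= u1 v1 u2 v2 !subr0.
Qed.

Lemma lattice_dim_coordinate : lattice_dim (R := R) coordinate_lattice 3.
Proof.
pose f (k : 'I_3) : 'I_(3 + m + n) := lshift n (lshift m k).
have f_inj : injective f by move=> k l /lshift_inj/lshift_inj.
pose X := [tuple (delta_mx 0 (f k) : 'rV[R]_(3 + m + n)) | k < 3].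
have XE (k : 'I_3) : X`_k = delta_mx 0 (f k) by rewrite -tnth_nth tnth_mktuple.
have Xfree : free X.
  apply/freeP => c /rowP Xc k; have := Xc (f k).
  rewrite summxE (bigD1 k) //= XE [in X in _ = X]mxE !mxE !eqxx mulr1 big1 ?addr0// => l lk.
  by rewrite XE !mxE eqxx /= (inj_eq f_inj) eq_sym (negPf lk) mulr0.
exists <<X>>%VS; last by move/eqP: Xfree; rewrite size_tuple.
split=> [_ [z [z1 z2] <-]|W HW].
  rewrite [toR z]row_sum_delta 2!big_split_ord /=.
  have z0 (k : 'I_m) : z 0 (lshift n (rshift 3 k)) = 0.
    by move/rowP/(_ k): z1; rewrite !mxE.
  have z0' (k : 'I_n) : z 0 (rshift (3 + m) k) = 0.
    by move/rowP/(_ k): z2; rewrite !mxE.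
  rewrite [X in _ + X + _]big1 => [|k _]; last by rewrite !mxE z0 scale0r.
  rewrite [X in _ + X]big1 => [|k _]; last by rewrite !mxE z0' scale0r.
  rewrite !addr0; apply: memv_suml => k _; apply: memvZ; apply: memv_span.
  by rewrite -/(f k) -XE mem_nth ?size_tuple.
apply/span_subvP => _ /mapP[k _ ->]; apply: HW.
exists (delta_mx 0 (f k)); last by rewrite /toR map_delta_mx.
by split; apply/rowP => i; rewrite !mxE /f ?eq_lshift eq_rlshift andbF.
Qed.

End CoordinateSubspace.

Section Degenerate.
Context {R : realType} {m n : nat}.
Variables (w : 'I_3 -> R) (lam : 'I_n -> R) (Theta : 'M[R]_(n, 3 + m)).
Hypotheses (n0 : (0 < n)%N) (wfree : forall c, ternary_form w c = 0 -> c = 0)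
  (lam12 : forall j, 1 <= lam j <= 2)
  (linformE : forall j x, rsubmx x = 0 ->
     linform Theta j x = lam j * ternary_form w (lsubmx x))
  (singular : forall X, (0 < X)%N -> exists x,
     [/\ x != 0, (height x <= X)%N & zeta Theta x * (X.+1 ^ 2)%:R <= 2])
  (degenerate : forall x j y, best_approx Theta x ->
     `|linform Theta j x + y%:~R| = dist_int (linform Theta j x) ->
     rsubmx x = 0 /\ y = 0).

Lemma coordinate_lattice_best z : ext_best_approx_seq Theta z ->
  forall nu, coordinate_lattice (z nu).
Proof.
move=> zb nu; have H j := degenerate (ebas_best zb nu) (ebas_ext zb nu j).
split; first by case: (H (Ordinal n0)).
by apply/rowP => j; rewrite (proj2 (H j)) mxE.
Qed.

Lemma eventually_in_dim_ge3 r : (exists z, ext_best_approx_seq Theta z) ->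
  eventually_in_dim Theta r -> (3 <= r)%N.
Proof.
move=> [z zb] [L [_ [V [VL _] <-] /(_ z zb) [N _ zL]]].
rewrite leqNgt; apply/negP => V2.
have zV k : (N <= k)%N -> toR (z k) \in V by move=> Nk; apply: VL; exists (z k) => //; exact: zL.
have zC := coordinate_lattice_best zb.
pose x k : 'rV[int]_3 := lsubmx (lsubmx (z k)).
have zE k : z k = row_mx (row_mx (x k) 0) 0.
  by case: (zC k) => z1 z2; rewrite -{1}[z k]hsubmxK z2 -[lsubmx (z k)]hsubmxK z1.
have lzE k : lsubmx (z k) = row_mx (x k) 0 by rewrite zE row_mxKl.
have hx k : height (lsubmx (z k)) = height (x k).
  apply/eqP; rewrite eqn_leq; apply/andP; split; apply/height_leP => i.
    rewrite lzE mxE; case: fintype.split => l; last by rewrite mxE.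
    exact: absz_le_height.
  by apply: leq_trans (absz_le_height _ (lshift m i)); rewrite lzE row_mxEl.
have distE j k : dist_int (linform Theta j (lsubmx (z k))) =
    lam j * `|ternary_form w (x k)|.
  case: (zC k) => z1 z2; rewrite -(ebas_ext zb) z2 mxE addr0 linformE//.
  by rewrite normrM ger0_norm//; have := lam12 j; lra.
have x0 k : x k != 0.
  have [] := ebas_best zb k; rewrite lzE => + _; apply: contraNneq => ->.
  by rewrite row_mx0.
have xS k : (height (x k) < height (x k.+1))%N by rewrite -!hx; exact: (ebas_incr zb).
have wS k : `|ternary_form w (x k.+1)| <= `|ternary_form w (x k)|.
  have [j zj] := zeta_attained Theta (lsubmx (z k)) n0.
  have lamj : 0 < lam j by have := lam12 j; lra.
  rewrite -(ler_pM2l lamj) -!distE -zj; apply: le_trans (dist_int_le_zeta _ _ _) _.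
  apply: (proj2 (ebas_best zb k.+1)); first by case: (ebas_best zb k).
  by rewrite !hx ltnW.
have wx2 k : `|ternary_form w (x k)| * (height (x k.+1) ^ 2)%:R <= 2.
  have h1 : (0 < (height (x k.+1)).-1)%N.
    by have := xS k; have := x0 k; rewrite -height_gt0; lia.
  have [x' [x'0 x'h x'2]] := singular h1.
  rewrite prednK in x'2; last by lia.
  apply: le_trans x'2; rewrite ler_wpM2r//.
  apply: le_trans (ext_best_approx_seq_le zb x'0 (_ : _ < height (lsubmx (z k.+1)))%N).
    apply: le_trans (dist_int_le_zeta _ (Ordinal n0) _); rewrite distE.
    by rewrite ler_peMl//; have := lam12 (Ordinal n0); lra.
  by rewrite hx; lia.
have toRE k i : (x k 0 i)%:~R = toR (z k) 0 (lshift n (lshift m i)) :> R by rewrite !mxE.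
have [i [j wij]] := wedge_neq0 wfree (x0 N) (xS N) (wS N).
have Xfree : free [:: toR (z N); toR (z N.+1) : 'rV[R]_(3 + m + n)].
  have wedge0 (u v : R) : (forall i, u * (x N 0 i)%:~R = v * (x N.+1 0 i)%:~R) ->
      u = 0 /\ v = 0.
    move=> uv; have wR : (wedge (x N) (x N.+1) i j)%:~R != 0 :> R by rewrite intr_eq0.
    split; apply/eqP; rewrite -[_ == 0](mulIr_eq0 _ (mulIf wR)); apply/eqP.
      by rewrite rmorphB !rmorphM /= mulrBr !mulrA !uv; ring.
    rewrite rmorphB !rmorphM /= mulrBr.
    rewrite [X in X - _](_ : _ = (v * (x N.+1 0 j)%:~R) * (x N 0 i)%:~R); last by ring.
    rewrite [X in _ - X](_ : _ = (v * (x N.+1 0 i)%:~R) * (x N 0 j)%:~R); last by ring.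
    by rewrite -!uv; ring.
  rewrite free_cons span_seq1 seq1_free; apply/andP; split.
    apply/negP => /vlineP[k zk].
    have [] := wedge0 1 k; last by move/eqP; rewrite oner_eq0.
    by move=> l; rewrite !toRE zk mxE mul1r.
  apply/eqP => z0; have [] := wedge0 0 1; last by move=> _ /eqP; rewrite oner_eq0.
  by move=> l; rewrite mul0r mul1r toRE z0 mxE.
have VE : V = <<[:: toR (z N); toR (z N.+1)]>>%VS.
  apply/esym/eqP; rewrite eqEdim (eqP Xfree); apply/andP; split; last exact: V2.
  by apply/span_subvP => v; rewrite !inE => /orP[]/eqP ->; exact: zV.
have /choice[pq pqP] k : exists pq : R * R, (N <= k)%N ->
    toR (z k) = pq.1 *: toR (z N) + pq.2 *: toR (z N.+1).
  have [Nk|Nk] := leqP N k; last by exists 0.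
  have := zV k Nk; rewrite VE span_cons span_seq1.
  by move=> /memv_addP[_ /vlineP[p ->] [_ /vlineP[q ->] E]]; exists (p, q).
apply: (@singular_seq_not_coplanar _ w wfree x N (fun k => (pq k).1) (fun k => (pq k).2)) => //.
by move=> k l Nk; rewrite !toRE (pqP k Nk) !mxE.
Qed.

End Degenerate.

Theorem theorem14 (R : realType) (m n : nat) (hm : (3 <= m)%N) (hn : (1 <= n)%N) :
  exists Theta : 'M[R]_(n, m),
    [/\ entries_and_1_free Theta,
        exists2 V : {vspace 'rV[R]_(m + n)}, \dim V = 3%N &
          forall z : nat -> 'rV[int]_(m + n), ext_best_approx_seq Theta z ->
            \forall nu \near \oo, toR (z nu) \in V
      & Rdim Theta = 3%N].
Proof.
rewrite -(subnKC hm); move: (m - 3)%N => {hm}m.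
have [w [lam [ Theta [wfree Tfree [lam12 linformE] singular degenerate]]]] :=
  @exists_degenerate_theta R m n hn.
have zC := coordinate_lattice_best hn degenerate.
exists Theta; split; first exact: Tfree.
  have [V [VL _] V3] := lattice_dim_coordinate (R := R) (m := m) (n := n).
  exists V => // z zb; apply: nearW => nu.
  by apply: VL; exists (z nu) => //; exact: zC.
have ev3 : eventually_in_dim Theta 3.
  exists coordinate_lattice; split; [exact: int_lattice_coordinate| |].
    exact: lattice_dim_coordinate.
  by move=> z zb; apply: nearW; exact: zC.
have zex : exists z, ext_best_approx_seq Theta z.
  apply: exists_ext_best_approx_seq => // e e0.
  pose X := (Num.bound (2 / e)).+1.
  have [x [x0 _ x2]] := singular X isT; exists x => //.
  rewrite ltNge; apply/negP => ex.
  have : 2 / e < X.+1%:R.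
    apply: lt_trans (_ : (Num.bound (2 / e))%:R < _); last by rewrite ltr_nat /X.
    by apply: archi_boundP; rewrite divr_ge0// ltW.
  rewrite ltr_pdivrMr// => Xe; move: x2; apply/negP; rewrite -ltNge.
  apply: lt_le_trans Xe _; rewrite mulrC ler_pM ?ler0n//; first exact: ltW.
  by rewrite ler_nat expnS leq_pmulr.
rewrite /Rdim; case: ex_minnP => r /asboolP rP rmin.
apply/eqP; rewrite eqn_leq rmin; last exact/asboolP.
exact: (eventually_in_dim_ge3 hn wfree lam12 linformE singular degenerate zex rP).
Qed.
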